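(* Let $\alpha\in[0,\frac{\pi}{2})$ and let $A \in \prod_{1,\alpha}^n$ (a sectorial matrix). Then \begin{equation*} \frac{1}{1+\sin(\alpha)}\|A\|\le w(A) \le \|A\|. \end{equation*}
   Context: $M_n$ ($n\ge 1$) is the algebra of $n\times n$ complex matrices acting on $\mathbb{C}^n$ with operator norm $\|\cdot\|$. $W(A)=\{\langle Ax,x\rangle: x\in\mathbb{C}^n,\ \|x\|=1\}$ and $w(A)=\sup\{|z|:z\in W(A)\}$. For $\alpha\in[0,\frac{\pi}{2})$ let $S_\alpha=\{z\in\mathbb{C}:\Re z>0,\ |\Im z|\le\tan(\alpha)\,\Re z\}$. $\prod_{1,\alpha}^n$ denotes the set of $A\in M_n$ with $W(A)\subseteq S_\alpha$. *)

(* Defs.v *)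
From HB Require Import structures.
From mathcomp Require Import all_boot all_order all_algebra.
From mathcomp Require Import complex.
From mathcomp Require Import all_classical all_reals all_analysis.

Set Implicit Arguments.
Unset Strict Implicit.
Unset Printing Implicit Defensive.

Import Order.TTheory GRing.Theory Num.Theory.
Local Open Scope classical_set_scope.
Local Open Scope complex_scope.
Local Open Scope ring_scope.

(* Matrices act on column vectors, while [dotmx] is the Hermitian product of
   row vectors, linear in its first argument. *)
Definition inner (R : realType) (n : nat) (x y : 'cV[R[i]]_n) : R[i] :=
  dotmx x^T y^T.

(* [inner x x] is a nonnegative real number inside R[i]. The library's
   norm on matrices is the maximum norm and is not used here. *)
Definition l2norm (R : realType) (n : nat) (x : 'cV[R[i]]_n) : R :=
  Num.sqrt (complex.Re (inner x x)).

Definition unit_sphere (R : realType) (n : nat) : set 'cV[R[i]]_n :=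
  [set x | l2norm x = 1].

Definition op_norm (R : realType) (n : nat) (A : 'M[R[i]]_n) : R :=
  sup [set l2norm (A *m x) | x in @unit_sphere R n].

Definition num_range (R : realType) (n : nat) (A : 'M[R[i]]_n) : set R[i] :=
  [set inner (A *m x) x | x in @unit_sphere R n].

(* The modulus [`|z|] has type R[i]; its real part is the same number in R. *)
Definition num_radius (R : realType) (n : nat) (A : 'M[R[i]]_n) : R :=
  sup [set complex.Re `|z| | z in num_range A].

Definition sector (R : realType) (alpha : R) : set R[i] :=
  [set z | 0 < complex.Re z /\
           `|complex.Im z| <= tan alpha * complex.Re z].

Definition sectorial (R : realType) (n : nat) (alpha : R) : set 'M[R[i]]_n :=
  [set A | num_range A `<=` sector alpha].

(* Main.v *)
Require Import Defs.
From HB Require Import structures.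
From mathcomp Require Import all_boot all_order all_algebra.
From mathcomp Require Import complex.
From mathcomp Require Import all_classical all_reals all_analysis.
From mathcomp Require Import ring lra.

(** The upper bound on the numerical radius w(A) is the Cauchy-Schwarz
    inequality (lemma [normc_inner_le]).

    For the lower bound, write A = H + iK with H and K Hermitian. Since
    <Hx, x> = Re <Ax, x>, the numerical radius of H is at most w(A). A point z
    of the sector makes an angle at most alpha with the positive real axis, so
    |Im z| <= sin alpha |z| (lemma [sector_Im_le]), and since
    <Kx, x> = Im <Ax, x>, the numerical radius of K is at most
    sin alpha w(A). The norm of a Hermitian matrix is its numerical radius, so
    ||A|| <= ||H|| + ||K|| <= (1 + sin alpha) w(A).

    Here H and K are not formed. The argument that bounds the norm of a
    Hermitian matrix by its numerical radius, namely polarization followed by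
    the parallelogram law, is applied to the form <Ax, y> itself, once with
    real parts and once with imaginary parts (lemma [Re_sesquilinear_le]).
    Taking y to be the unit vector along Ax turns this
    into a bound on ||Ax|| (lemma [l2norm_mulmx_le]).

    The suprema are meaningful because a matrix is bounded on the unit sphere
    (lemma [l2norm_mulmx_bounded]) and the unit sphere is nonempty when
    1 <= n (lemma [unit_sphere_neq0]). *)

Import Order.TTheory GRing.Theory Num.Theory.
Local Open Scope classical_set_scope.
Local Open Scope complex_scope.
Local Open Scope ring_scope.

(** * The inner product and its norm *)

Lemma innerE {R : realType} {n : nat} (x y : 'cV[R[i]]_n) :
  inner x y = \sum_i x i 0 * Num.conj (y i 0).
Proof.
by rewrite /inner dotmxE mxE; apply: eq_bigr => i _; rewrite !mxE.
Qed.

Lemma innerDl {R : realType} {n : nat} (x y z : 'cV[R[i]]_n) :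
  inner (x + y) z = inner x z + inner y z.
Proof. by rewrite /inner linearD linearDl. Qed.

Lemma innerDr {R : realType} {n : nat} (x y z : 'cV[R[i]]_n) :
  inner x (y + z) = inner x y + inner x z.
Proof. by rewrite /inner linearD linearDr. Qed.

Lemma innerZl {R : realType} {n : nat} (a : R[i]) (x y : 'cV[R[i]]_n) :
  inner (a *: x) y = a * inner x y.
Proof. by rewrite /inner linearZ linearZl_LR. Qed.

Lemma innerZr {R : realType} {n : nat} (a : R[i]) (x y : 'cV[R[i]]_n) :
  inner x (a *: y) = Num.conj a * inner x y.
Proof. by rewrite /inner linearZ linearZr_LR. Qed.

Lemma inner_ge0 {R : realType} {n : nat} (x : 'cV[R[i]]_n) :
  0 <= inner x x.
Proof. exact: dnorm_ge0. Qed.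

Lemma inner_self {R : realType} {n : nat} (x : 'cV[R[i]]_n) :
  inner x x = (l2norm x ^+ 2)%:C.
Proof.
rewrite /l2norm sqr_sqrtr ?RRe_real ?ger0_real ?inner_ge0 //.
by have := inner_ge0 x; rewrite lecE => /andP[].
Qed.

Lemma l2norm_ge0 {R : realType} {n : nat} (x : 'cV[R[i]]_n) :
  0 <= l2norm x.
Proof. exact: sqrtr_ge0. Qed.

Lemma l2norm_eq0 {R : realType} {n : nat} (x : 'cV[R[i]]_n) :
  (l2norm x == 0) = (x == 0).
Proof.
have := dnorm_eq0 (@dotmx R[i] n) x^T.
have -> : (x^T == 0) = (x == 0) by rewrite -trmx0 (inj_eq (@trmx_inj _ _ _)).
move=> <-; transitivity (inner x x == 0) => //.
by rewrite inner_self eq_complex /= eqxx andbT sqrf_eq0.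
Qed.

Lemma l2normZ {R : realType} {n : nat} (a : R) (x : 'cV[R[i]]_n) :
  l2norm (a%:C *: x) = `|a| * l2norm x.
Proof.
have -> : `|a| * l2norm x = Num.sqrt ((a * l2norm x) ^+ 2).
  by rewrite sqrtr_sqr normrM (ger0_norm (l2norm_ge0 x)).
rewrite {1}/l2norm innerZl innerZr inner_self; congr Num.sqrt; simpc => /=.
by rewrite mulrA exprMn expr2.
Qed.

Lemma Re_normc {R : realType} (z : R[i]) : (complex.Re `|z|)%:C = `|z|.
Proof. by rewrite RRe_real ?normr_real. Qed.

Lemma Re_normc_ge0 {R : realType} (z : R[i]) : 0 <= complex.Re `|z|.
Proof. by rewrite -lecR Re_normc normr_ge0. Qed.

Lemma inner_CauchySchwarz {R : realType} {n : nat} (x y : 'cV[R[i]]_n) :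
  complex.Re `|inner x y| <= l2norm x * l2norm y.
Proof.
have [le_CS _] := CauchySchwarz (@dotmx R[i] n) x^T y^T.
have {}le_CS : `|inner x y| ^+ 2 <= inner x x * inner y y := le_CS.
move: le_CS; rewrite !inner_self -Re_normc -rmorphXn -rmorphM lecR /= -exprMn.
by rewrite ler_sqr ?nnegrE ?mulr_ge0 ?l2norm_ge0 ?Re_normc_ge0.
Qed.

(** * Polarization *)

Lemma biadditiveB {V C : zmodType} {f : V -> V -> C}
    (fDl : forall x y z, f (x + y) z = f x z + f y z)
    (fDr : forall x y z, f x (y + z) = f x y + f x z) :
  (forall x y z, f (x - y) z = f x z - f y z) /\
  (forall x y z, f x (y - z) = f x y - f x z).
Proof.
split=> x y z; apply/esym/eqP; rewrite subr_eq.
  by rewrite -fDl subrK.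
by rewrite -fDr subrK.
Qed.

(** The codomain is abstract because this identity is applied to the
    real-valued form Re <x, y> and the next one to the complex-valued
    <Ax, y>. *)
Lemma biadditive_parallelogram {V : zmodType} {C : comNzRingType}
    {f : V -> V -> C}
    (fDl : forall x y z, f (x + y) z = f x z + f y z)
    (fDr : forall x y z, f x (y + z) = f x y + f x z) (x y : V) :
  f (x + y) (x + y) + f (x - y) (x - y) = (f x x + f y y) *+ 2.
Proof.
have [fBl fBr] := biadditiveB fDl fDr.
rewrite fDl fBl !fBr !fDr; ring.
Qed.

Lemma biadditive_polarization {V : zmodType} {C : comNzRingType}
    {f : V -> V -> C}
    (fDl : forall x y z, f (x + y) z = f x z + f y z)
    (fDr : forall x y z, f x (y + z) = f x y + f x z) (x y : V) :
  f (x + y) (x + y) - f (x - y) (x - y) = (f x y + f y x) *+ 2.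
Proof.
have [fBl fBr] := biadditiveB fDl fDr.
rewrite fDl fBl !fBr !fDr; ring.
Qed.

(** Polarization at (x, y) bounds Re (f x y + f y x), twice the Hermitian part
    of the form, by means of [hRe]. Polarization at (x, 'i y) bounds
    Re (f x y - f y x), twice the skew-Hermitian part, by means of [hIm]:
    since f is conjugate-linear on the right, f x ('i y) + f ('i y) x is
    - 'i (f x y - f y x), and Im (- 'i z) = - Re z. The parallelogram law
    [q_par] adds up the bounds at the two points of each polarization. Here
    [q] stands for the squared norm. *)
Lemma Re_sesquilinear_le {R : realType} {V : lmodType R[i]} {f : V -> V -> R[i]}
    {q : V -> R} {h k : R}
    (fDl : forall x y z, f (x + y) z = f x z + f y z)
    (fDr : forall x y z, f x (y + z) = f x y + f x z)
    (fZl : forall a x y, f (a *: x) y = a * f x y)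
    (fZr : forall a x y, f x (a *: y) = Num.conj a * f x y)
    (q_par : forall x y, q (x + y) + q (x - y) = (q x + q y) *+ 2)
    (qi : forall x, q ('i *: x) = q x)
    (hRe : forall x, `|complex.Re (f x x)| <= h * q x)
    (hIm : forall x, `|complex.Im (f x x)| <= k * q x) (x y : V) :
  complex.Re (f x y) *+ 2 <= (h + k) * (q x + q y).
Proof.
have bound c (u v : V) (g : R[i] -> R)
    (gB : forall z z', g (z - z') = g z - g z')
    (g_le : forall x, `|g (f x x)| <= c * q x) :
    `|g ((f u v + f v u) *+ 2)| <= (c * (q u + q v)) *+ 2.
  rewrite -biadditive_polarization // gB -mulrnAr -q_par mulrDr.
  by apply: le_trans (ler_normB _ _) _; apply: lerD.
have ReB (z z' : R[i]) : complex.Re (z - z') = complex.Re z - complex.Re z'.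
  by case: z z' => [? ?] [? ?].
have ImB (z z' : R[i]) : complex.Im (z - z') = complex.Im z - complex.Im z'.
  by case: z z' => [? ?] [? ?].
have := bound h x y _ ReB hRe; have := bound k x ('i *: y) _ ImB hIm.
rewrite qi fZl fZr; case: (f x y) => a b; case: (f y x) => c d.
rewrite !mulr2n /= !ler_norml => /andP[le1 _] /andP[_ le2].
by move: le1 le2; rewrite /= => le1 le2; lra.
Qed.

Lemma sqr_l2norm_parallelogram {R : realType} {n : nat} (x y : 'cV[R[i]]_n) :
  l2norm (x + y) ^+ 2 + l2norm (x - y) ^+ 2 =
  (l2norm x ^+ 2 + l2norm y ^+ 2) *+ 2.
Proof.
pose q (u : 'cV[R[i]]_n) := l2norm u ^+ 2.
pose f (u v : 'cV[R[i]]_n) := complex.Re (inner u v).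
have qE : q = fun u => f u u by apply/funext => u; rewrite /q /f inner_self.
rewrite -[LHS]/(q (x + y) + q (x - y)) -[RHS]/((q x + q y) *+ 2) qE.
by apply: biadditive_parallelogram => u v w;
  rewrite /f (innerDl, innerDr) raddfD.
Qed.

Lemma sqr_l2norm_i {R : realType} {n : nat} (x : 'cV[R[i]]_n) :
  l2norm ('i *: x) ^+ 2 = l2norm x ^+ 2.
Proof.
apply: (@complexI R); rewrite -[LHS]inner_self -[RHS]inner_self.
by rewrite innerZl innerZr mulrA; simpc.
Qed.

(** Use of [Re_sesquilinear_le] with y the unit vector along Ax, for which
    <Ax, y> = ||Ax||. The constants [h] and [k] bound the numerical radii of
    the Hermitian and skew-Hermitian parts of A. *)
Lemma l2norm_mulmx_le {R : realType} {n : nat} {A : 'M[R[i]]_n} {h k : R}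
    (hRe : forall x, `|complex.Re (inner (A *m x) x)| <= h * l2norm x ^+ 2)
    (hIm : forall x, `|complex.Im (inner (A *m x) x)| <= k * l2norm x ^+ 2)
    (x : 'cV[R[i]]_n) :
  l2norm x = 1 -> l2norm (A *m x) <= h + k.
Proof.
move=> x1; have [Ax0|Ax_neq0] := eqVneq (l2norm (A *m x)) 0.
  have := hRe x; have := hIm x; rewrite Ax0 x1 expr1n !mulr1.
  move=> /(le_trans (normr_ge0 _)) k0 /(le_trans (normr_ge0 _)) h0.
  exact: addr_ge0.
pose y := (l2norm (A *m x))^-1%:C *: (A *m x).
have y1 : l2norm y = 1.
  by rewrite l2normZ ger0_norm ?invr_ge0 ?l2norm_ge0 // mulVf.
have Dl u v z : inner (A *m (u + v)) z = inner (A *m u) z + inner (A *m v) z.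
  by rewrite mulmxDr innerDl.
have Zl a u v : inner (A *m (a *: u)) v = a * inner (A *m u) v.
  by rewrite -scalemxAr innerZl.
have := Re_sesquilinear_le Dl (fun u => innerDr (A *m u)) Zl
  (fun a u => innerZr a (A *m u)) sqr_l2norm_parallelogram sqr_l2norm_i
  hRe hIm x y.
have -> : inner (A *m x) y = (l2norm (A *m x))%:C.
  rewrite innerZr inner_self.
  have -> : Num.conj (l2norm (A *m x))^-1%:C = (l2norm (A *m x))^-1%:C.
    exact: conjc_real.
  by rewrite -rmorphM expr2 mulKf.
rewrite x1 y1 expr1n -mulr2n mulrnAr mulr1 /=.
by rewrite lerMn2r.
Qed.

(** * The two suprema *)

Lemma unit_sphere_neq0 {R : realType} {n : nat} :
  (1 <= n)%N -> @unit_sphere R n !=set0.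
Proof.
case: n => // n _; exists (delta_mx 0 0); rewrite /unit_sphere /=.
apply/eqP; rewrite -(@eqrXn2 _ 2) ?l2norm_ge0 // expr1n.
rewrite -(inj_eq (@complexI R)) -inner_self innerE.
rewrite (bigD1 ord0) //= big1 ?addr0 => [|i /negPf i0].
  by rewrite mxE eqxx andbT -normCK normr1 expr1n.
by rewrite !mxE i0 mul0r.
Qed.

(** Each entry of Ax is the inner product of x with a conjugated row of A, so
    Cauchy-Schwarz bounds ||Ax|| by the Frobenius norm of A. *)
Lemma l2norm_mulmx_bounded {R : realType} {n : nat} (A : 'M[R[i]]_n) :
  exists M : R, forall x, l2norm x = 1 -> l2norm (A *m x) <= M.
Proof.
pose r i : 'cV[R[i]]_n := \col_j Num.conj (A i j).
have entry x i : (A *m x) i 0 = inner x (r i).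
  by rewrite innerE mxE; apply: eq_bigr => j _; rewrite !mxE conjCK mulrC.
exists (Num.sqrt (\sum_i l2norm (r i) ^+ 2)) => x x1.
rewrite -[leLHS]ger0_norm ?l2norm_ge0 // -sqrtr_sqr ler_wsqrtr //.
rewrite -lecR -inner_self innerE rmorph_sum /=; apply: ler_sum => i _.
rewrite entry -normCK -Re_normc -rmorphXn lecR /=.
rewrite ler_sqr ?nnegrE ?l2norm_ge0 ?Re_normc_ge0 //.
by have := inner_CauchySchwarz x (r i); rewrite x1 mul1r.
Qed.

Lemma op_norm_ge {R : realType} {n : nat} (A : 'M[R[i]]_n) (x : 'cV[R[i]]_n) :
  l2norm x = 1 -> l2norm (A *m x) <= op_norm A.
Proof.
move=> x1; apply: ub_le_sup; last by exists x.
have [M leM] := l2norm_mulmx_bounded A; exists M => _ [u u1 <-]; exact: leM.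
Qed.

Lemma normc_inner_le {R : realType} {n : nat} (A : 'M[R[i]]_n)
    (x : 'cV[R[i]]_n) :
  l2norm x = 1 -> complex.Re `|inner (A *m x) x| <= op_norm A.
Proof.
move=> x1; apply: le_trans (inner_CauchySchwarz _ _) _.
by rewrite x1 mulr1 op_norm_ge.
Qed.

Lemma num_radius_ge {R : realType} {n : nat} (A : 'M[R[i]]_n)
    (x : 'cV[R[i]]_n) :
  l2norm x = 1 -> complex.Re `|inner (A *m x) x| <= num_radius A.
Proof.
move=> x1; apply: ub_le_sup; last by exists (inner (A *m x) x) => //; exists x.
by exists (op_norm A) => _ [_ [u u1 <-] <-]; apply: normc_inner_le.
Qed.

(** * Quadratic forms and sectors *)

Lemma inner_normalize {R : realType} {n : nat} (A : 'M[R[i]]_n)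
    (x : 'cV[R[i]]_n) :
  x != 0 -> exists2 u, l2norm u = 1 &
    inner (A *m x) x = (l2norm x ^+ 2)%:C * inner (A *m u) u.
Proof.
rewrite -l2norm_eq0 => x_neq0; exists ((l2norm x)^-1%:C *: x).
  by rewrite l2normZ ger0_norm ?invr_ge0 ?l2norm_ge0 // mulVf.
rewrite -scalemxAr innerZl innerZr mulrA mulrA.
have -> : Num.conj (l2norm x)^-1%:C = (l2norm x)^-1%:C by exact: conjc_real.
by rewrite -!rmorphM /= expr2 mulfK // mulfV // rmorph1 mul1r.
Qed.

(** Passage from the unit sphere, over which the numerical radius is defined,
    to the homogeneous bounds required by [l2norm_mulmx_le]; [f] is the real
    or the imaginary part. *)
Lemma quadratic_form_le {R : realType} {n : nat} {A : 'M[R[i]]_n}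
    {f : R[i] -> R} {c : R} (fM : forall t z, f (t%:C * z) = t * f z)
    (hf : forall u, l2norm u = 1 -> `|f (inner (A *m u) u)| <= c)
    (x : 'cV[R[i]]_n) :
  `|f (inner (A *m x) x)| <= c * l2norm x ^+ 2.
Proof.
have [->|/(inner_normalize A)[u u1 ->]] := eqVneq x 0.
  have -> : l2norm (0 : 'cV[R[i]]_n) = 0 by apply/eqP; rewrite l2norm_eq0.
  have -> : inner (A *m 0) 0 = 0%:C * 0 :> R[i].
    by rewrite mulr0 /inner trmx0 linear0r.
  by rewrite fM mul0r normr0 expr0n mulr0.
by rewrite fM normrM ger0_norm ?sqr_ge0 // mulrC ler_wpM2r ?sqr_ge0 // hf.
Qed.

(** Multiplying |Im z| <= tan alpha Re z by cos alpha and squaring gives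
    (1 - sin^2 alpha) (Im z)^2 <= sin^2 alpha (Re z)^2, and so
    (Im z)^2 <= sin^2 alpha |z|^2. *)
Lemma sector_Im_le {R : realType} {alpha : R} {z : R[i]} :
  0 <= alpha -> alpha < pi / 2 -> sector alpha z ->
  `|complex.Im z| <= sin alpha * complex.Re `|z|.
Proof.
move=> alpha0 alpha1 [Re_gt0 Im_le].
have pi0 := pi_gt0 R.
have cos0 : 0 < cos alpha by apply: cos_gt0_pihalf; apply/andP; split; lra.
have sin0 : 0 <= sin alpha by apply: sin_ge0_pi; apply/andP; split; lra.
have cIm : cos alpha * `|complex.Im z| <= sin alpha * complex.Re z.
  rewrite mulrC -ler_pdivlMr //; apply: le_trans Im_le _.
  by rewrite /tan mulrAC.
have z0 := Re_normc_ge0 z.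
have z2 : complex.Re `|z| ^+ 2 = complex.Re z ^+ 2 + complex.Im z ^+ 2.
  by apply: (@complexI R); rewrite add_Re2_Im2 rmorphXn /= Re_normc.
rewrite -ler_sqr ?nnegrE ?mulr_ge0 // exprMn z2 real_normK ?num_real //.
have : (cos alpha * `|complex.Im z|) ^+ 2 <= (sin alpha * complex.Re z) ^+ 2.
  by rewrite ler_sqr // nnegrE mulr_ge0 // ltW.
rewrite !exprMn real_normK ?num_real //.
have := cos2Dsin2 alpha; nra.
Qed.

Theorem corollary4p2 (R : realType) (n : nat) (hn : (1 <= n)%N)
    (alpha : R) (halpha0 : 0 <= alpha) (halpha1 : alpha < pi / 2)
    (A : 'M[R[i]]_n) (hA : sectorial alpha A) :
  1 / (1 + sin alpha) * op_norm A <= num_radius A /\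
  num_radius A <= op_norm A.
Proof.
have [x0 x01] := @unit_sphere_neq0 R n hn.
have sin0 : 0 <= sin alpha.
  by have := pi_gt0 R => pi0; apply: sin_ge0_pi; apply/andP; split; lra.
split; last first.
  apply: ge_sup; first by exists (complex.Re `|inner (A *m x0) x0|),
    (inner (A *m x0) x0) => //; exists x0.
  by move=> _ [_ [u u1 <-] <-]; apply: normc_inner_le.
rewrite mul1r mulrC ler_pdivrMr; last by lra.
apply: ge_sup; first by exists (l2norm (A *m x0)), x0.
move=> _ [x x1 <-]; rewrite mulrDr mulr1 (mulrC (num_radius A)).
apply: l2norm_mulmx_le x1.
- apply: (quadratic_form_le (f := @complex.Re R)) => [t [a b]|u u1].
    by rewrite /= mul0r subr0.
  apply: le_trans (num_radius_ge A u u1).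
  by rewrite -lecR Re_normc normc_ge_Re.
- apply: (quadratic_form_le (f := @complex.Im R)) => [t [a b]|u u1].
    by rewrite /= mul0r addr0.
  apply: le_trans (sector_Im_le halpha0 halpha1 (hA _ _)) _; first by exists u.
  by rewrite ler_wpM2l // num_radius_ge.
Qed.
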